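(* Let $s\geq 1$ and let $f\in \mathbb{C}[x_1,\ldots,x_s]$ be a weighted homogeneous polynomial of weighted degree $d$ with respect to $w=(w_1,\ldots,w_s)\in\mathbb{N}^s$ that defines an isolated hypersurface singularity. Assume that $d\geq 2w_1\geq 2w_2\geq\cdots\geq 2w_s>0$. Then for every $n\geq 2$ the graded algebra $\mathbb{C}[x_1,\ldots,x_s]/\langle f,\mathcal{J}_n(f)\rangle$ does not admit negative weighted derivations; that is, every $\mathbb{C}$-linear derivation of this algebra into itself that is weighted homogeneous of negative degree is zero.
   Context: Weighted homogeneity: a polynomial $f=\sum_\alpha c_\alpha x^\alpha\in\mathbb{C}[x_1,\ldots,x_s]$ is weighted homogeneous of weighted degree $d$ with respect to $w=(w_1,\ldots,w_s)$, with all $w_i$ positive integers, if $\alpha\cdot w=\sum_i\alpha_iw_i=d$ whenever $c_\alpha\neq 0$. One writes $\deg_w(f)=d$. Isolated singularity: $f$ defines an isolated hypersurface singularity if the origin is an isolated singular point of the hypersurface $\{f=0\}$, i.e. an isolated point of the common zero set in $\mathbb{C}^s$ of $f$ and $\partial f/\partial x_1,\ldots,\partial f/\partial x_s$. Higher-order Jacobian matrix: for $n\geq 1$, the Jacobian matrix of order $n$ of $f$ is $$\operatorname{Jac}_n(f)=\left(\frac{1}{(\alpha-\beta)!}\frac{\partial^{\alpha-\beta}f}{\partial x^{\alpha-\beta}}\right)_{\beta,\alpha},$$ with rows indexed by $\beta\in\mathbb{N}^s$ with $0\leq|\beta|\leq n-1$ and columns indexed by $\alpha\in\mathbb{N}^s$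 with $1\leq|\alpha|\leq n$. The entry is defined to be $0$ whenever $\alpha_i<\beta_i$ for some $i$, or $\alpha=\beta$. Here $|\alpha|=\alpha_1+\cdots+\alpha_s$, $\gamma!=\gamma_1!\cdots\gamma_s!$, $\mathbb{N}$ contains $0$, and $\frac{\partial^{\gamma}}{\partial x^{\gamma}}=\frac{\partial^{|\gamma|}}{\partial x_1^{\gamma_1}\cdots\partial x_s^{\gamma_s}}$. It is an $M\times(N-1)$ matrix with $M=\binom{n+s-1}{s}$ and $N=\binom{n+s}{s}$. The ideal $\mathcal{J}_n(f)\subseteq\mathbb{C}[x_1,\ldots,x_s]$ is generated by all maximal (i.e. $M\times M$) minors of $\operatorname{Jac}_n(f)$. Grading: for $f$ weighted homogeneous, $\mathcal{J}_n(f)$ is a weighted homogeneous ideal, so $T=\mathbb{C}[x_1,\ldots,x_s]/\langle f,\mathcal{J}_n(f)\rangle$ is a graded algebra $T=\bigoplus_{i\geq0}T_i$, where $x_i$ has degree $w_i$. A $\mathbb{C}$-linear derivation $\delta:T\to T$ is weighted homogeneous of degree $k\in\mathbb{Z}$ if $\delta(T_i)\subseteq T_{i+k}$ for all $i$ (with $T_j=0$ for $j<0$). A negative weighted derivation is a nonzero weighted homogeneous derivation of degree $k<0$. *)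

(* Defs.v *)
From HB Require Import structures.
From mathcomp Require Import all_boot all_order all_algebra ring_quotient complex.
From mathcomp Require Import boolp classical_sets reals topology.
From mathcomp Require Import mpoly.

Set Implicit Arguments.
Unset Strict Implicit.
Unset Printing Implicit Defensive.

Import Order.TTheory GRing.Theory Num.Theory.
Import numFieldTopology.Exports.

Local Open Scope classical_set_scope.
Local Open Scope quotient_scope.
Local Open Scope ring_scope.

Section GeneratedIdeal.
Variables (A : comNzRingType) (S : set A).

Definition gen_ideal : set A :=
  [set p | exists2 r : seq (A * A), {in r, forall x, S x.2}
                                  & p = \sum_(x <- r) x.1 * x.2].

Definition gen_ideal_pred : {pred A} := fun p => `[< gen_ideal p >].

Lemma gen_idealP p : reflect (gen_ideal p) (p \in gen_ideal_pred).
Proof. exact: asboolP. Qed.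

Lemma gen_ideal_mull a p : p \in gen_ideal_pred -> a * p \in gen_ideal_pred.
Proof.
case/gen_idealP=> r Sr ->; apply/gen_idealP.
exists [seq (a * x.1, x.2) | x <- r] => [_ /mapP[x xr ->]|]; first exact: (Sr x xr).
by rewrite big_map mulr_sumr; apply: eq_bigr => x _ /=; rewrite mulrA.
Qed.

Lemma gen_ideal_zmod_closed : zmod_closed gen_ideal_pred.
Proof.
split=> [|p q pI]; first by apply/gen_idealP; exists [::]; [move=> x; rewrite in_nil | rewrite big_nil].
move/(gen_ideal_mull (-1)); rewrite mulN1r.
case/gen_idealP: pI => r Sr -> /gen_idealP[t St ->]; apply/gen_idealP.
exists (r ++ t) => [x|]; last by rewrite big_cat.
by rewrite mem_cat => /orP[/Sr|/St].
Qed.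

HB.instance Definition _ :=
  GRing.isZmodClosed.Build A gen_ideal_pred gen_ideal_zmod_closed.

End GeneratedIdeal.

(* The library's ring structure on an ideal quotient asks for [1 \notin I]; only
   the underlying additive quotient is used here, so that A / <S> is defined
   (as a possibly trivial ring) for every S. *)
Definition quot_alg (K : fieldType) (A : comAlgType K) (S : set A) : Type :=
  {ideal_quot (gen_ideal_pred S : zmodClosed A)}.

Section QuotientAlgebra.
Variables (K : fieldType) (A : comAlgType K) (S : set A).
Local Notation Q := (quot_alg S).
Local Notation I := (gen_ideal_pred S).

HB.instance Definition _ := GRing.Zmodule.on Q.

Definition quot_proj (p : A) : Q := \pi_({ideal_quot (I : zmodClosed A)}) p.

Lemma quot_projP p q : (quot_proj p = quot_proj q) <-> gen_ideal S (p - q).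
Proof.
rewrite (rwP (gen_idealP S (p - q))) Quotient.idealrBE.
by split=> [?|/eqP //]; apply/eqP.
Qed.

Lemma quot_proj_surj (t : Q) : exists p, t = quot_proj p.
Proof. by exists (repr t); rewrite /quot_proj reprK. Qed.

Lemma quot_projD : {morph quot_proj : p q / p + q}.
Proof. by move=> p q; rewrite /quot_proj raddfD. Qed.

Definition quot_one : Q := quot_proj 1.
Definition quot_mul (t u : Q) : Q :=
  quot_proj (repr (t : {ideal_quot (I : zmodClosed A)}) *
             repr (u : {ideal_quot (I : zmodClosed A)})).
Definition quot_scale (c : K) (t : Q) : Q :=
  quot_proj (c *: repr (t : {ideal_quot (I : zmodClosed A)})).

Lemma repr_quot_proj p :
  gen_ideal S (repr (quot_proj p : {ideal_quot (I : zmodClosed A)}) - p).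
Proof. by apply/quot_projP; rewrite /quot_proj reprK. Qed.

Lemma quot_mulE p q : quot_mul (quot_proj p) (quot_proj q) = quot_proj (p * q).
Proof.
apply/quot_projP; set p' := repr _; set q' := repr _.
have -> : p' * q' - p * q = q' * (p' - p) + p * (q' - q).
  by rewrite !mulrBr [q' * p']mulrC [q' * p]mulrC addrA subrK.
by apply/gen_idealP/rpredD; apply/gen_ideal_mull/gen_idealP/repr_quot_proj.
Qed.

Lemma quot_scaleE c p : quot_scale c (quot_proj p) = quot_proj (c *: p).
Proof.
apply/quot_projP; rewrite -scalerBr -mulr_algl.
by apply/gen_idealP/gen_ideal_mull/gen_idealP/repr_quot_proj.
Qed.

Let quotE := (quot_mulE, quot_scaleE, =^~ quot_projD).

Fact quot_mulA : associative quot_mul.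
Proof.
move=> t u v; have [[p ->] [q ->] [r ->]] :=
  And3 (quot_proj_surj t) (quot_proj_surj u) (quot_proj_surj v).
by rewrite !quotE mulrA.
Qed.

Fact quot_mulC : commutative quot_mul.
Proof. by move=> t u; rewrite /quot_mul mulrC. Qed.

Fact quot_mul1 : left_id quot_one quot_mul.
Proof.
by move=> t; have [p ->] := quot_proj_surj t; rewrite !quotE mul1r.
Qed.

Fact quot_mulDl : left_distributive quot_mul +%R.
Proof.
move=> t u v; have [[p ->] [q ->] [r ->]] :=
  And3 (quot_proj_surj t) (quot_proj_surj u) (quot_proj_surj v).
by rewrite !quotE mulrDl.
Qed.

HB.instance Definition _ := GRing.Zmodule_isComPzRing.Build Q
  quot_mulA quot_mulC quot_mul1 quot_mulDl.

Fact quot_scaleA a b t : quot_scale a (quot_scale b t) = quot_scale (a * b) t.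
Proof.
by have [p ->] := quot_proj_surj t; rewrite !quotE scalerA.
Qed.

Fact quot_scale1 : left_id 1 quot_scale.
Proof.
by move=> t; have [p ->] := quot_proj_surj t; rewrite !quotE scale1r.
Qed.

Fact quot_scaleDr : right_distributive quot_scale +%R.
Proof.
move=> a t u; have [[p ->] [q ->]] := conj (quot_proj_surj t) (quot_proj_surj u).
by rewrite !quotE scalerDr.
Qed.

Fact quot_scaleDl t : {morph quot_scale^~ t : a b / a + b}.
Proof.
by move=> a b; have [p ->] := quot_proj_surj t; rewrite !quotE scalerDl.
Qed.

HB.instance Definition _ := GRing.Zmodule_isLmodule.Build K Q
  quot_scaleA quot_scale1 quot_scaleDr quot_scaleDl.

Lemma quot_projM : {morph quot_proj : p q / p * q}.
Proof. by move=> p q; rewrite -quot_mulE. Qed.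

Lemma quot_proj1 : quot_proj 1 = 1. Proof. by []. Qed.

Lemma quot_projZ c : {morph quot_proj : p / c *: p}.
Proof. by move=> p; rewrite -quot_scaleE. Qed.

Definition is_derivation (delta : Q -> Q) : Prop :=
  linear delta /\ forall t u, delta (t * u) = delta t * u + t * delta u.

End QuotientAlgebra.

Section WeightedDegree.
Variables (s : nat) (w : 'I_s -> nat).

Definition wdeg (m : 'X_{1..s}) : nat := (\sum_(i < s) m i * w i)%N.

Fact wdeg0 : wdeg 0%MM = 0%N.
Proof. by apply: big1 => i _; rewrite mnm0E. Qed.

Fact wdegD : {morph wdeg : m1 m2 / (m1 + m2)%MM >-> (m1 + m2)%N}.
Proof.
by move=> m1 m2; rewrite -big_split; apply: eq_bigr => i _; rewrite mnmDE mulnDl.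
Qed.

HB.instance Definition _ := isMeasure.Build s wdeg wdeg0 wdegD.

Definition weighted_homog (R : nzRingType) (d : nat) (f : {mpoly R[s]}) : Prop :=
  f \is d.-homog for wdeg.

End WeightedDegree.

Section HigherJacobian.
Variables (K : fieldType) (s n : nat) (f : {mpoly K[s]}).

Definition jac_rows : finType := 'X_{1..s < n}.
Definition jac_cols : finType := {a : 'X_{1..s < n.+1} | (0 < mdeg a)%N}.

(* Meant for characteristic 0, where the factorials are invertible. *)
Definition jac_entry (b a : 'X_{1..s}) : {mpoly K[s]} :=
  if (b <= a)%MM && (a != b)
  then (\prod_(i < s) ((a - b)%MM i)`!)%:R^-1 *: f^`M[a - b]
  else 0.

(* Rows and columns are listed in the enumeration order of their index types;
   another order only changes the signs of the maximal minors. *)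
Definition higher_jacobian : 'M[{mpoly K[s]}]_(#|jac_rows|, #|jac_cols|) :=
  \matrix_(i, j) jac_entry (bmnm (enum_val i)) (bmnm (val (enum_val j))).

Definition is_maximal_minor (p : {mpoly K[s]}) : Prop :=
  exists2 g : 'I_#|jac_rows| -> 'I_#|jac_cols|,
    {homo g : i j / (i < j)%N} & p = \det (colsub g higher_jacobian).

Definition higher_jacobian_ideal : set {mpoly K[s]} :=
  gen_ideal is_maximal_minor.

Definition higher_tjurina_algebra : Type :=
  quot_alg ([set f] `|` higher_jacobian_ideal).

End HigherJacobian.

Section Grading.
Variables (K : fieldType) (s : nat) (w : 'I_s -> nat) (S : set {mpoly K[s]}).
Local Notation Q := (quot_alg S).

(* The image of the polynomials of weighted degree j; zero in negative degrees. *)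
Definition graded_piece (j : int) : set Q :=
  match j with
  | Posz i => [set t | exists2 p, weighted_homog w i p & t = quot_proj S p]
  | Negz _ => [set 0]
  end.

Definition weighted_homog_map (k : int) (delta : Q -> Q) : Prop :=
  forall i : nat, delta @` graded_piece i `<=` graded_piece (i%:Z + k).

End Grading.

(* Row vectors over [R[i]] carry the product topology of the norm topology; the
   cast is what makes the topology of a [numFieldType] available on [R[i]]. *)
Definition isolated_singularity (R : realType) (s : nat)
    (f : {mpoly (R[i])[s]}) : Prop :=
  isolated [set v : 'rV[(R[i] : numFieldType)]_s |
             f.@[v 0] = 0 /\ forall i : 'I_s, f^`M(i).@[v 0] = 0] 0.

(* Main.v *)
(* A derivation [delta] of degree [k < 0] is induced by a vector field
   [D = \sum_i a_i d/dx_i] with [deg a_i = w_i + k]. In the determinant defining a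
   maximal minor, every nonzero term involves at least two first derivatives of
   [f], each of degree at least [d - w_1 >= d / 2]; hence [<f, J_n(f)>] vanishes in
   degrees below [d]. As [D f] lies in this ideal and has degree [d + k < d], the
   equality [D f = 0] holds in the polynomial ring, so [a] is a syzygy of the
   partial derivatives of [f]. These vanish simultaneously only at the origin, by
   isolatedness and the weighted scaling action, so they generate an ideal
   containing powers of all variables, and their Koszul complex is exact in
   degree 1. Thus every [a_i] lies in the ideal of the partial derivatives, which
   vanishes in degrees below [d - w_1 >= w_1 > w_i + k]; so [a_i = 0]. *)
Require Import Defs.
From HB Require Import structures.
From mathcomp Require Import all_boot all_order all_algebra complex.
From mathcomp Require Import boolp classical_sets reals topology.
From mathcomp Require Import mpoly.
From mathcomp Require Import perm zify lra.

Set Implicit Arguments.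
Unset Strict Implicit.
Unset Printing Implicit Defensive.

Import Order.TTheory GRing.Theory Num.Theory.

Local Open Scope ring_scope.

Definition is_ideal (A : comNzRingType) (J : A -> Prop) : Prop :=
  [/\ J 0, forall p q, J p -> J q -> J (p + q) & forall a p, J p -> J (a * p)].

(** * Exactness of Koszul complexes *)

Section Koszul.
Variable A : comNzRingType.
Implicit Types (J : A -> Prop) (g c : nat -> A).

(* [ext m] is the exterior algebra on [e_0, ..., e_(m-1)]: the pair [(a, b)] of
   [ext m.+1] stands for [a + e_m b]. Then [contract g] is the Koszul differential
   of [g], and [wedge c] the left multiplication by [\sum_i c_i e_i]. *)
Fixpoint ext (m : nat) : lmodType A :=
  if m is m'.+1 then (ext m' * ext m')%type else A^o.

Fixpoint contract g m : ext m -> ext m :=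
  if m is m'.+1 return ext m -> ext m
  then fun z => (contract g z.1 + g m' *: z.2, - contract g z.2)
  else fun=> 0.

Fixpoint wedge c m : ext m -> ext m :=
  if m is m'.+1 return ext m -> ext m
  then fun z => (wedge c z.1, c m' *: z.1 - wedge c z.2)
  else fun=> 0.

Fixpoint ext1 m : ext m :=
  if m is m'.+1 return ext m then (ext1 m', 0) else 1.

(** The [i]-th exterior power; since [e_m] itself has degree 1, an element of degree 0 has no [e_m]
    part. *)
Fixpoint ext_deg m i : ext m -> Prop :=
  if m is m'.+1 return ext m -> Prop
  then fun z => ext_deg i z.1 /\ (if i is i'.+1 then ext_deg i' z.2 else z.2 = 0)
  else fun z => if i is _.+1 then z = 0 else True.

Fixpoint ext_in J m : ext m -> Prop :=
  if m is m'.+1 return ext m -> Prop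
  then fun z => ext_in J z.1 /\ ext_in J z.2
  else fun z => J z.

Lemma contract_linear g m : linear (@contract g m).
Proof.
elim: m => [|m IH] a z t /=; first by rewrite scaler0 addr0.
congr pair; rewrite /= IH ?scalerDr ?opprD ?scalerN //.
by rewrite !scalerA [g m * a]mulrC addrACA.
Qed.

HB.instance Definition _ g m :=
  GRing.isLinear.Build A (ext m) (ext m) _ (@contract g m) (@contract_linear g m).

Lemma wedge_linear c m : linear (@wedge c m).
Proof.
elim: m => [|m IH] a z t /=; first by rewrite scaler0 addr0.
congr pair; rewrite /= IH ?scalerDr ?opprD ?scalerN //.
by rewrite !scalerA [c m * a]mulrC addrACA.
Qed.

HB.instance Definition _ c m :=
  GRing.isLinear.Build A (ext m) (ext m) _ (@wedge c m) (@wedge_linear c m).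

Lemma contractK g m (z : ext m) : contract g (contract g z) = 0.
Proof.
elim: m z => [//|m IH] z /=; congr pair; last by rewrite linearN /= IH !oppr0.
by rewrite linearD /= IH linearZ /= add0r scalerN subrr.
Qed.

(** A Cartan homotopy formula: it makes multiplication by [\sum_i c_i g_i] null-homotopic on the
    Koszul complex of [g]. *)
Lemma contract_wedge g c m (z : ext m) :
  contract g (wedge c z) + wedge c (contract g z) = (\sum_(i < m) c i * g i) *: z.
Proof.
elim: m z => [|m IH] z /=; first by rewrite big_ord0 scale0r addr0.
rewrite big_ord_recr /= [RHS]surjective_pairing; congr pair => /=.
  rewrite [wedge c (_ + _)]linearD /= [wedge c (_ *: _)]linearZ /= scalerBr addrACA subrK.
  by rewrite IH scalerDl scalerA [g m * c m]mulrC.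
rewrite [contract g (_ - _)]linearB /= [contract g (_ *: _)]linearZ /=.
rewrite [wedge c (- _)]linearN /= opprK opprB scalerDr scalerA.
by rewrite !addrA subrK addrAC IH scalerDl.
Qed.

Lemma ext_degD m i (z t : ext m) : ext_deg i z -> ext_deg i t -> ext_deg i (z + t).
Proof.
elim: m i z t => [|m IH] [|i] //= z t; first by move=> -> ->; rewrite addr0.
  by move=> [? z2] [? t2]; split; [apply: IH|rewrite /= z2 t2 addr0].
by move=> [? ?] [? ?]; split; apply: IH.
Qed.

Lemma ext_degZ m i a (z : ext m) : ext_deg i z -> ext_deg i (a *: z).
Proof.
elim: m i z => [|m IH] [|i] //= z; first by move=> ->; rewrite scaler0.
  by move=> [? z2]; split; [apply: IH|rewrite /= z2 scaler0].
by move=> [? ?]; split; apply: IH.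
Qed.

Lemma ext_deg_large m i (z : ext m) : ext_deg i z -> (m < i)%N -> z = 0.
Proof.
elim: m i z => [|m IH] [|i] //= z [dz1 dz2] lt_mi.
by rewrite [z]surjective_pairing (IH _ _ dz1 (ltnW lt_mi)) (IH _ _ dz2 lt_mi).
Qed.

Lemma ext_deg_wedge c m i (z : ext m) : ext_deg i z -> ext_deg i.+1 (wedge c z).
Proof.
elim: m i z => [|m IH] [|i] //= z [dz1 dz2]; (split; first exact: IH) => /=.
  by rewrite dz2 linear0 subr0; apply: ext_degZ.
by apply: ext_degD; [exact: ext_degZ | rewrite -scaleN1r; apply/ext_degZ/IH].
Qed.

Lemma ext_deg_ext1 m : ext_deg 0 (ext1 m).
Proof. by elim: m => [|m IH]. Qed.

Section ExtIn.
Variables (J : A -> Prop) (idealJ : is_ideal J).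

Lemma ext_in0 m : ext_in J (0 : ext m).
Proof. by elim: m => [|m IH] /=; [case: idealJ|split]. Qed.

Lemma ext_inD m (z t : ext m) : ext_in J z -> ext_in J t -> ext_in J (z + t).
Proof.
elim: m z t => [|m IH] /= z t; first by case: idealJ => _ + _; exact.
by move=> [? ?] [? ?]; split; apply: IH.
Qed.

Lemma ext_inZ m a (z : ext m) : ext_in J z -> ext_in J (a *: z).
Proof.
elim: m z => [|m IH] /= z; first by case: idealJ => _ _; exact.
by move=> [? ?]; split; apply: IH.
Qed.

Lemma ext_inN m (z : ext m) : ext_in J z -> ext_in J (- z).
Proof. by rewrite -scaleN1r; exact: ext_inZ. Qed.

Lemma ext_inB m (z t : ext m) : ext_in J z -> ext_in J t -> ext_in J (z - t).
Proof. by move=> Jz Jt; apply/ext_inD/ext_inN. Qed.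

Lemma ext_in_scale m a (z : ext m) : J a -> ext_in J (a *: z).
Proof.
move=> Ja; elim: m z => [|m IH] z /=; last by split; apply: IH.
by case: idealJ => _ _ JM; rewrite /GRing.scale /= mulrC; apply: JM.
Qed.

Lemma ext_in_contract_sub g m (z : ext m) : ext_in J z -> ext_in J (contract g z).
Proof.
elim: m z => [|m IH] z /=; first by move=> _; case: idealJ.
by move=> [? ?]; split; [apply/ext_inD/ext_inZ => //|apply/ext_inN]; apply: IH.
Qed.

Lemma ext_in_wedge_sub c m (z : ext m) : ext_in J z -> ext_in J (wedge c z).
Proof.
elim: m z => [|m IH] z /=; first by move=> _; case: idealJ.
by move=> [? ?]; split; [apply: IH|apply/ext_inB/IH => //; apply: ext_inZ].
Qed.

Lemma ext_in_contract g m (z : ext m) :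
  (forall i, (i < m)%N -> J (g i)) -> ext_in J (contract g z).
Proof.
elim: m z => [|m IH] z Jg /=; first by case: idealJ.
have {}IH t : ext_in J (@contract g m t) by apply: IH => i /ltnW; apply: Jg.
by split; [apply/ext_inD/ext_in_scale/Jg|apply/ext_inN]; rewrite ?ltnSn.
Qed.

Lemma ext_in_ext1 m a : ext_in J (a *: ext1 m) -> J a.
Proof.
elim: m => [|m IH] /=; first by rewrite /GRing.scale /= mulr1.
by case=> /IH.
Qed.

Lemma ext_in_wedge_ext1 c m :
  ext_in J (wedge c (ext1 m)) -> forall i, (i < m)%N -> J (c i).
Proof.
elim: m => [//|m IH] /= [/IH Jc]; rewrite linear0 subr0 => /ext_in_ext1 Jm i.
by rewrite ltnS leq_eqVlt => /orP[/eqP -> //|/Jc].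
Qed.

End ExtIn.

Lemma ext_in_split (I J : A -> Prop) theta m (z : ext m) :
  (forall p, J p -> exists u v, p = theta * u + v /\ I v) ->
  ext_in J z -> exists u v : ext m, z = theta *: u + v /\ ext_in I v.
Proof.
move=> JI; elim: m z => [|m IH] /= z; first by move=> /JI.
move=> [/IH[u1 [v1 [z1 Iv1]]] /IH[u2 [v2 [z2 Iv2]]]].
exists (u1, u2), (v1, v2); split => //.
by case: z z1 z2 => a b /= -> ->.
Qed.

Lemma ext_in_regular (I : A -> Prop) theta m (z : ext m) :
  (forall p, I (theta * p) -> I p) -> ext_in I (theta *: z) -> ext_in I z.
Proof.
by move=> reg; elim: m z => [|m IH] /= z; [apply: reg|case=> /IH ? /IH].
Qed.

Section Exactness.
Variables (s : nat) (g theta : nat -> A) (I : nat -> A -> Prop).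
(** The model is [I k] generated by [theta 0], ..., [theta (k-1)], for a regular sequence [theta]
    inside the ideal of [g]. *)
Hypothesis I_ideal : forall k, is_ideal (I k).
Hypothesis I_sub : forall k p, I k p -> I k.+1 p.
Hypothesis I_theta : forall k, (k < s)%N -> I k.+1 (theta k).
Hypothesis I_split : forall k p, (k < s)%N -> I k.+1 p ->
  exists u v, p = theta k * u + v /\ I k v.
Hypothesis I_regular : forall k p, (k < s)%N -> I k (theta k * p) -> I k p.
Hypothesis theta_in : forall k, (k < s)%N ->
  exists c : nat -> A, theta k = \sum_(i < s) c i * g i.

(* Multiplication by [theta k] is null-homotopic on the Koszul complex of [g],
   so by the long exact sequence of [theta k] the homology modulo [I k] is a
   quotient of the homology modulo [I k.+1], one degree higher; modulo [I s] the
   degree exceeds the top one. *)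
Lemma koszul_exact_mod k i (z : ext s) : (k <= s)%N -> (k < i)%N ->
  ext_deg i z -> ext_in (I k) (contract g z) ->
  exists u v : ext s, z = contract g u + v /\ ext_in (I k) v.
Proof.
move=> le_ks; move def_j: (s - k)%N => j.
elim: j k i z le_ks def_j => [|j IH] k i z le_ks def_j lt_ki deg_z dz.
  have -> : z = 0.
    by apply: (ext_deg_large deg_z); apply: leq_ltn_trans lt_ki; rewrite -subn_eq0 def_j.
  by exists 0, 0; rewrite linear0 addr0; split=> //; apply: ext_in0.
have lt_ks : (k < s)%N by rewrite -subn_gt0 def_j.
have [c theta_c] := theta_in lt_ks.
have sub m (y : ext m) : ext_in (I k) y -> ext_in (I k.+1) y.
  by elim: m y => [|m IHm] y /=; [apply: I_sub|case=> /IHm ? /IHm].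
have dwz : contract g (wedge c z) = theta k *: z - wedge c (contract g z).
  by rewrite theta_c -contract_wedge addrK.
have wdz : ext_in (I k) (wedge c (contract g z)) by apply: ext_in_wedge_sub.
have [|||||y [v [wz_eq Iv]]] := IH k.+1 i.+1 (wedge c z).
- exact: lt_ks.
- by rewrite subnS def_j.
- by rewrite ltnS.
- exact: ext_deg_wedge.
- rewrite dwz; apply: ext_inB => //; last exact: sub.
  by apply: ext_in_scale => //; apply: I_theta.
(* Modulo [I k] the error [v] is a multiple of [theta k]. The quotient [u] is the required primitive
   of [z]: [contract g] kills the boundary in [wz_eq], and [theta k] cancels modulo [I k]. *)
have [u [v' [v_eq Iv']]] := ext_in_split (fun p => @I_split k p lt_ks) Iv.
exists u, (z - contract g u); split; first by rewrite addrC subrK.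
apply: (@ext_in_regular (I k) (theta k)); first by move=> p; exact: I_regular.
have -> : theta k *: (z - contract g u) = contract g v' + wedge c (contract g z).
  rewrite scalerBr; apply/eqP; rewrite subr_eq addrAC -subr_eq -dwz wz_eq v_eq.
  by rewrite raddfD /= contractK add0r raddfD /= linearZ /= addrC.
apply: ext_inD => //; exact: ext_in_contract_sub.
Qed.

(** The relation makes [\sum_i a_i e_i], encoded as [wedge a (ext1 s)], a Koszul cycle of degree 1,
    hence a boundary; boundaries have coefficients in any ideal containing the [g i]. *)
Lemma koszul_syzygy (J : A -> Prop) (a : nat -> A) :
  is_ideal J -> (forall i, (i < s)%N -> J (g i)) -> (forall p, I 0 p -> p = 0) ->
  \sum_(i < s) a i * g i = 0 -> forall i, (i < s)%N -> J (a i).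
Proof.
move=> idealJ Jg I0 rel; apply: ext_in_wedge_ext1.
have d1 m : contract g (ext1 m) = 0.
  by elim: m => //= m ->; rewrite scaler0 addr0 linear0 oppr0.
have dw : contract g (wedge a (ext1 s)) = 0.
  by have := contract_wedge g a (ext1 s); rewrite d1 linear0 addr0 rel scale0r.
have [|u [v [-> Iv]]] := @koszul_exact_mod 0 1 (wedge a (ext1 s)) (leq0n _) (ltnSn _)
  (ext_deg_wedge _ (ext_deg_ext1 s)); first by rewrite dw; apply: ext_in0.
apply: ext_inD => //; first exact: ext_in_contract.
have -> : v = 0; last exact: ext_in0.
elim: (s) v Iv => [|m IH] /= v; first exact: I0.
by case: v => v1 v2 /= [/IH -> /IH ->].
Qed.

End Exactness.
End Koszul.

(** * Nullstellensatz over an uncountable field *)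

Lemma subitv_avoiding_seq (R : realFieldType) (r : seq R) (a b : R) : a < b ->
  exists c : R * R, [/\ a <= c.1, c.1 < c.2, c.2 <= b &
    forall x, x \in r -> ~~ (c.1 <= x <= c.2)].
Proof.
elim: r a b => [|y r IH] a b ab; first by exists (a, b).
have [y_lo|y_hi] := ltP y ((a + b) / 2%:R).
- have [|c [ac cc cb cr]] := IH ((a + b) / 2%:R) b; first by lra.
  exists c; split=> // [|x]; first by lra.
  by rewrite inE => /orP[/eqP ->|/cr //]; apply/negP => /andP[]; lra.
(* A third rather than a half, as [y] may be the midpoint. *)
- have [|c [ac cc cb cr]] := IH a (a + (b - a) / 3%:R); first by lra.
  exists c; split=> // [|x]; first by lra.
  by rewrite inE => /orP[/eqP ->|/cr //]; apply/negP => /andP[]; lra.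
Qed.

(* Nested intervals, the n-th one disjoint from [F n]. *)
Lemma real_not_countable_union_seq (R : realType) (F : nat -> seq R) :
  exists x, forall n, x \notin F n.
Proof.
pose itv := {c : R * R | c.1 < c.2}.
have step_ex n (c : itv) : exists c' : itv, [/\ (val c).1 <= (val c').1,
    (val c').2 <= (val c).2 &
    forall x, x \in F n -> ~~ ((val c').1 <= x <= (val c').2)].
  case: c => c cP /=; have [c' [? c'P ? ?]] := subitv_avoiding_seq (F n) cP.
  by exists (exist (fun c : R * R => c.1 < c.2) c' c'P).
pose I := fix I n : itv := if n is n'.+1 then sval (cid (step_ex n' (I n')))
                           else exist (fun c : R * R => c.1 < c.2) (0, 1) ltr01.
have stepP n : [/\ (val (I n)).1 <= (val (I n.+1)).1,
    (val (I n.+1)).2 <= (val (I n)).2 &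
    forall x, x \in F n -> ~~ ((val (I n.+1)).1 <= x <= (val (I n.+1)).2)].
  by rewrite /=; case: cid.
have lo_le m n : (m <= n)%N -> (val (I m)).1 <= (val (I n)).1.
  move=> /subnK <-; elim: (n - m)%N => [//|k IH].
  by case: (stepP (k + m)%N) => + _ _; apply: le_trans.
have hi_ge m n : (m <= n)%N -> (val (I n)).2 <= (val (I m)).2.
  move=> /subnK <-; elim: (n - m)%N => [//|k IH].
  by case: (stepP (k + m)%N) => _ + _; move=> /le_trans; apply.
have lo_hi m n : (val (I m)).1 <= (val (I n)).2.
  apply: le_trans (lo_le _ _ (leq_maxl m n)) _.
  apply: le_trans (hi_ge _ _ (leq_maxr m n)).
  by case: (I (maxn m n)) => c /= /ltW.
pose L : set R := range (fun n => (val (I n)).1).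
have L0 : (L !=set0)%classic by exists (val (I 0%N)).1, 0%N.
have Lub n : ubound L (val (I n)).2 by move=> _ [m _ <-].
(* The supremum of the left endpoints lies in every interval, so in the one chosen to avoid
   [F n]. *)
exists (sup L) => n; apply/negP => inF; case: (stepP n) => _ _ /(_ _ inF)/negP; apply.
rewrite ge_sup // andbT; apply: ub_le_sup; last by exists n.+1.
by exists (val (I 0%N)).2.
Qed.

Lemma complex_not_countable_union_seq (R : realType) (F : nat -> seq R[i]) :
  exists x, forall n, x \notin F n.
Proof.
have [x xF] := real_not_countable_union_seq (fun n => map (@complex.Re R) (F n)).
exists (x%:C)%C => n; apply: contra (xF n) => xFn.
by apply/mapP; exists (x%:C)%C.
Qed.

Lemma ideal_sum (A : comNzRingType) (J : A -> Prop) (I : Type) (r : seq I)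
  (B : pred I) (F : I -> A) : is_ideal J -> (forall i, B i -> J (F i)) ->
  J (\sum_(i <- r | B i) F i).
Proof. by case=> J0 JD _ JF; elim/big_ind: _. Qed.

Lemma idealB (A : comNzRingType) (J : A -> Prop) p q :
  is_ideal J -> J p -> J q -> J (p - q).
Proof. by case=> _ JD JM Jp Jq; apply: JD => //; rewrite -mulN1r; apply: JM. Qed.

Section MaximalAvoidingIdeal.
Variables (A : comNzRingType) (h : A).

Definition avoids_powers (P : A -> Prop) := forall N, ~ P (h ^+ N).

(** Maximality among the ideals without powers of [h], in elementwise form: adjoining any [a]
    outside [P] brings in a power of [h]. *)
Definition maximal_avoiding (P : A -> Prop) :=
  [/\ is_ideal P, avoids_powers P &
      forall a, ~ P a -> exists N q, P (h ^+ N - q * a)].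

Lemma exists_maximal_avoiding (J : A -> Prop) : is_ideal J -> avoids_powers J ->
  exists P, maximal_avoiding P /\ forall a, J a -> P a.
Proof.
move=> idealJ avoidJ.
(* The union with [J] settles the empty chain: its union is empty, and [J] itself qualifies. *)
pose Q (X : set A) := is_ideal (fun a => X a \/ J a) /\ avoids_powers (fun a => X a \/ J a).
have [F sFQ totF|P [[idealP avoidP] maxP]] := @Zorn_bigcup A Q.
  split; last first.
    by move=> N [[X FX XN]|/avoidJ //]; case: (sFQ X FX) => _ /(_ N); apply; left.
  case: idealJ => J0 JD JM; split; first by right.
  - have sum X p q : F X -> X p \/ J p -> X q \/ J q ->
        (\bigcup_(X in F) X)%classic (p + q) \/ J (p + q).
      move=> FX Xp Xq; case: (sFQ X FX) => -[_ XD _] _.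
      by case: (XD p q Xp Xq) => ?; [left; exists X|right].
    move=> p q [[X FX Xp]|Jp] [[Y FY Yq]|Jq]; last by right; apply: JD.
    + case: (totF X Y FX FY) => sub.
        by apply: (sum Y) => //; left => //; apply: sub.
      by apply: (sum X) => //; left => //; apply: sub.
    + by apply: (sum X) => //; [left|right].
    + by apply: (sum Y) => //; [right|left].
  - move=> a p [[X FX Xp]|Jp]; last by right; apply: JM.
    case: (sFQ X FX) => -[_ _ XM] _.
    by case: (XM a p (or_introl Xp)) => ?; [left; exists X|right].
pose P' a := P a \/ J a.
exists P'; split; last by move=> a; right.
split=> // a nPa; apply: contrapT => none.
(* The ideal generated by [P'] and [a]; free of powers of [h], it would contradict maximality. *)
pose P'' b := exists q, P' (b - q * a).
have sub b : P' b -> P'' b by exists 0; rewrite mul0r subr0.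
apply: (maxP P''); first split.
- by move=> b Pb; apply: sub; left.
- move=> subP; apply: nPa; left; apply: subP.
  by exists 1; rewrite mul1r subrr; case: idealP.
case: (idealP) => P0 PD PM.
have absorb b : P'' b \/ J b -> P'' b by case=> // Jb; apply: sub; right.
split; last first.
  by move=> N /absorb[q Pq]; apply: none; exists N, q.
split; first by left; apply: sub.
- move=> p q /absorb[u Pu] /absorb[v Pv]; left; exists (u + v).
  by rewrite mulrDl opprD addrACA; apply: PD.
- by move=> b p /absorb[u Pu]; left; exists (b * u); rewrite -mulrA -mulrBr; apply: PM.
Qed.

Variables (P : A -> Prop) (maxP : maximal_avoiding P).

(** If neither factor were in [P], powers of [h] would lie in [P + (a)] and [P + (b)], and their
    product in [P + (a b) = P]. *)
Lemma maximal_avoiding_prime a b : P (a * b) -> P a \/ P b.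
Proof.
case: maxP => idealP avoidP ext Pab; case: (idealP) => _ PD PM.
apply: contrapT => /not_orP[/ext[N [q Pq]] /ext[M [r Pr]]].
apply: (avoidP (N + M)%N).
have -> : h ^+ (N + M) = h ^+ M * (h ^+ N - q * a) + q * a * (h ^+ M - r * b)
   + q * r * (a * b).
  rewrite exprD !mulrBr [h ^+ M * h ^+ N]mulrC [q * a * (r * b)]mulrACA.
  by rewrite [h ^+ M * (q * a)]mulrC addrA !subrK.
by apply: (PD); [apply: (PD)|]; apply: (PM).
Qed.

Lemma maximal_avoiding_proper : ~ P 1.
Proof. by case: maxP => _ /(_ 0%N). Qed.

Lemma maximal_avoiding_prime_prod (I : Type) (r : seq I) (F : I -> A) :
  P (\prod_(i <- r) F i) -> exists i, P (F i).
Proof.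
elim: r => [|i r IH]; first by rewrite big_nil => /maximal_avoiding_proper.
by rewrite big_cons => /maximal_avoiding_prime[]; [exists i|].
Qed.

End MaximalAvoidingIdeal.

Lemma bounded_uniq_cover (T : eqType) (B : T -> Prop) (k : nat) :
  (forall r : seq T, uniq r -> {in r, forall x, B x} -> (size r <= k)%N) ->
  exists r : seq T, forall x, B x -> x \in r.
Proof.
move=> bound; apply: contrapT => nocover.
have [r [ur Br sr]] : exists r : seq T, [/\ uniq r, {in r, forall x, B x} & size r = k.+1].
  elim: k.+1 => [|m [r [ur Br sr]]]; first by exists [::].
  have /existsNP[x /not_implyP[Bx xr]] : ~ forall x, B x -> x \in r.
    by move=> cov; apply: nocover; exists r.
  exists (x :: r); split=> /=; [by rewrite ur andbT; apply/negP| |by rewrite sr].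
  by move=> z; rewrite inE => /orP[/eqP -> //|/Br].
by have := bound r ur Br; rewrite sr ltnn.
Qed.

Section Nullstellensatz.
Variables (K : closedFieldType) (s : nat).
Hypothesis uncountableK : forall F : nat -> seq K, exists x, forall n, x \notin F n.
Local Notation A := {mpoly K[s]}.
Variables (h : A) (P : A -> Prop) (maxP : maximal_avoiding h P).

Let idealP : is_ideal P. Proof. by case: maxP. Qed.

Lemma bounded_dependence (D k : nat) (q : 'I_k -> A) :
  (forall i, msize (q i) <= D)%N -> (#|{: 'X_{1..s < D}}| < k)%N ->
  exists2 a : 'I_k -> K, (exists i, a i != 0) & \sum_i a i *: q i = 0.
Proof.
move=> qD lt_k.
pose M := \matrix_(i < k, j < #|{: 'X_{1..s < D}}|) (q i)@_(bmnm (enum_val j)).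
have : kermx M != 0.
  rewrite -mxrank_eq0 mxrank_ker subn_eq0 -ltnNge.
  exact: leq_ltn_trans (rank_leq_col _) lt_k.
move=> /matrix0Pn[i0 [j0 nz]]; exists (kermx M i0); first by exists j0.
apply/mpolyP => m; rewrite raddf_sum mcoeff0 /=.
have [mD|Dm] := ltnP (mdeg m) D; last first.
  apply: big1 => i _; rewrite mcoeffZ memN_msupp_eq0 ?mulr0 //.
  by apply: msize_mdeg_ge; apply: leq_trans Dm.
have /matrixP/(_ i0 (enum_rank (BMultinom mD))) := mulmx_ker M.
rewrite !mxE => dep; rewrite -[RHS]dep; apply: eq_bigr => i _.
by rewrite mcoeffZ [M _ _]mxE enum_rankK.
Qed.

(* If no [y - c] is in [P], every [c] yields an inverse [q c] of [y - c] modulo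
   [P], up to a power of [h]; uncountably many [c] share that power and a degree
   bound for [q c], and a linear relation among these [q c] makes [y] algebraic
   over [K] modulo [P]. *)
Lemma maximal_avoiding_residue (y : A) : exists c : K, P (y - c%:A).
Proof.
apply: contrapT => none.
have [_ avoidP extP] := maxP; have [P0 PD PM] := idealP.
have inv c : exists ND : nat * nat, exists q : A,
    P (h ^+ ND.1 - q * (y - c%:A)) /\ (msize q <= ND.2)%N.
  have [|N [q Pq]] := extP (y - c%:A); first by move=> Pc; apply: none; exists c.
  by exists (N, msize q), q.
pose B (ND : nat * nat) c := exists q : A,
    P (h ^+ ND.1 - q * (y - c%:A)) /\ (msize q <= ND.2)%N.
have cover ND : exists r : seq K, forall c, B ND c -> c \in r.
  apply: (@bounded_uniq_cover _ _ #|{: 'X_{1..s < ND.2}}|) => r ur Br.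
  rewrite leqNgt; apply/negP => lt_r.
  have {}Br (i : 'I_(size r)) : B ND r`_i by apply/Br/mem_nth.
  have [q qP] := choice Br.
  have [a [i0 nz] dep] := bounded_dependence (fun i => (qP i).2) lt_r.
  (* Up to a scalar, [pr i] is the Lagrange polynomial of the node [r_i], so evaluation at [r_i0]
     isolates the nonzero [a i0] and shows that [p] is nonzero. *)
  pose pr i : {poly K} := \prod_(j < size r | j != i) ('X - (r`_j)%:P).
  pose p : {poly K} := \sum_i a i *: pr i.
  have nzp : p != 0.
    apply/eqP => /(congr1 (fun p => p.[r`_i0])) /eqP; rewrite horner0 horner_sum.
    rewrite (bigD1 i0) //= [X in _ + X]big1 ?addr0 => [|i ne_i]; last first.
      by rewrite hornerZ horner_prod (bigD1 i0) 1?eq_sym /= ?hornerXsubC ?subrr ?mul0r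
        ?mulr0 //.
    rewrite hornerZ mulf_eq0 (negbTE nz) /= horner_prod prodf_seq_eq0.
    move=> /hasP[j _ /andP[ne_j]]; rewrite hornerXsubC subr_eq0 nth_uniq //.
    by move=> /eqP/val_inj ij; rewrite ij eqxx in ne_j.
  have hp : P (h ^+ ND.1 * horner_alg y p).
    pose full := \prod_(j < size r) (y - (r`_j)%:A).
    have hornerp : horner_alg y p = \sum_i (a i)%:A * horner_alg y (pr i).
      by rewrite linear_sum; apply: eq_bigr => i _; rewrite linearZ /= mulr_algl.
    have mul_rel (x1 x2 x3 x4 x5 : A) : x1 * (x2 * x3) - x2 * x4 * (x5 * x3) =
        x2 * x3 * (x1 - x4 * x5).
      by rewrite mulrBr; congr (_ - _); [rewrite mulrC|rewrite [x5 * x3]mulrC mulrACA].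
    (* Modulo [P], [h ^+ ND.1] is [q i * (y - r_i)], and [y - r_i] times the value of [pr i] at [y]
       is [full]; the relation [dep] then kills the sum. *)
    have -> : h ^+ ND.1 * horner_alg y p =
        \sum_i (a i)%:A * horner_alg y (pr i) * (h ^+ ND.1 - q i * (y - (r`_i)%:A)).
      transitivity (h ^+ ND.1 * horner_alg y p - (\sum_i a i *: q i) * full).
        by rewrite dep mul0r subr0.
      rewrite hornerp mulr_sumr mulr_suml -sumrB; apply: eq_bigr => i _.
      have -> : full = (y - (r`_i)%:A) * horner_alg y (pr i).
        rewrite /full (bigD1 i) //= rmorph_prod; congr (_ * _).
        by apply: eq_bigr => j _; rewrite rmorphB /= horner_algX horner_algC.
      by rewrite -[a i *: q i]mulr_algl -mul_rel.
    by apply: ideal_sum => // i _; apply: PM; case: (qP i).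
  case: (maximal_avoiding_prime maxP hp) => [/avoidP //|].
  (* Over the closed field [p] splits; primality puts a nonzero constant or some [y - c] in [P],
     both excluded. *)
  have [z ->] := closed_field_poly_normal p.
  rewrite linearZ /= -mulr_algl => /(maximal_avoiding_prime maxP)[Pl|].
    apply: (maximal_avoiding_proper maxP).
    have := PM (lead_coef p)^-1%:A _ Pl.
    by rewrite mulr1 mulr_algl scalerA mulVf ?scale1r // lead_coef_eq0.
  rewrite rmorph_prod => /(maximal_avoiding_prime_prod maxP)[c].
  by rewrite rmorphB /= horner_algX horner_algC => Pc; apply: none; exists c.
have [r rP] := choice cover.
have [x xr] := uncountableK (fun n => if unpickle n is Some ND then r ND else [::]).
have [ND Bx] := inv x.
by have := xr (pickle ND); rewrite pickleK (rP ND x Bx).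
Qed.

(** The coordinates of [v] are the residues of the variables, and congruence to the value at [v] is
    preserved by sums and products. *)
Lemma maximal_avoiding_point : exists v : 'I_s -> K, forall p : A, P (p - (p.@[v])%:MP).
Proof.
have [_ PD PM] := idealP.
have [v vP] := choice (fun i : 'I_s => maximal_avoiding_residue 'X_i).
have closedM p q : P (p - (p.@[v])%:MP) -> P (q - (q.@[v])%:MP) ->
    P (p * q - ((p * q).@[v])%:MP).
  move=> Pp Pq; rewrite mevalM mpolyCM.
  have -> : p * q - p.@[v]%:MP * q.@[v]%:MP =
      q * (p - p.@[v]%:MP) + p.@[v]%:MP * (q - q.@[v]%:MP).
    by rewrite !mulrBr [q * p]mulrC [q * _%:MP]mulrC addrA subrK.
  by apply: (PD); apply: (PM).
have closedC c : P (c%:MP - ((c%:MP).@[v])%:MP).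
  by rewrite mevalC subrr; case: idealP.
exists v; elim/mpolyind => [|c m p _ _ IH].
  by rewrite meval0 mpolyC0 subrr; case: idealP.
rewrite mevalD mpolyCD opprD addrACA; apply: (PD) => //.
rewrite -mul_mpolyC; apply: (closedM) => //.
rewrite mpolyXE_id; apply: (big_ind (fun q : A => P (q - (q.@[v])%:MP))) => [|p1 p2|i _].
- by rewrite -mpolyC1.
- exact: closedM.
- elim: (m i) => [|k IHk]; first by rewrite expr0 -mpolyC1.
  by rewrite exprS; apply: closedM; rewrite // mevalXU -[_%:MP]alg_mpolyC.
Qed.

End Nullstellensatz.

(** If [J] contained no power of [h], a maximal such ideal [P] above [J] would have a residue point
    [v]. As [1] is not in [P], [J] vanishes at [v]; hence so does [h], which puts [h] in [P]. *)
Lemma nullstellensatz (K : closedFieldType) (s : nat) (h : {mpoly K[s]})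
    (J : {mpoly K[s]} -> Prop) :
  (forall F : nat -> seq K, exists x, forall n, x \notin F n) ->
  is_ideal J ->
  (forall v : 'I_s -> K, (forall p, J p -> p.@[v] = 0) -> h.@[v] = 0) ->
  exists N, J (h ^+ N).
Proof.
move=> uncountableK idealJ zeros; apply: contrapT => /forallNP avoidJ.
have [P [maxP JP]] := exists_maximal_avoiding idealJ avoidJ.
have [idealP avoidP _] := maxP; have [_ _ PM] := idealP.
have [v vP] := maximal_avoiding_point uncountableK maxP.
apply: (avoidP 1%N); rewrite expr1 -[h]subr0 -[X in _ - X]mpolyC0 -(zeros v) // => p Jp.
apply: contrapT => /eqP nz; apply: (maximal_avoiding_proper maxP).
have -> : 1 = ((p.@[v])^-1)%:MP * (p - (p - (p.@[v])%:MP)).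
  by rewrite opprB addrC subrK -mpolyCM mulVf // mpolyC1.
by apply: PM; apply: idealB => //; apply: JP.
Qed.

(** * Weighted degrees of the maximal minors *)

Section WeightFiltration.
Variables (s : nat) (w : 'I_s -> nat).

Lemma wdeg1 i : wdeg w U_(i)%MM = w i.
Proof.
rewrite /wdeg (bigD1 i) //= mnm1E eqxx mul1n big1 ?addn0 // => j ne_ji.
by rewrite mnm1E eq_sym (negbTE ne_ji).
Qed.

Lemma wdeg_le W m : (forall i, (w i <= W)%N) -> (wdeg w m <= W * mdeg m)%N.
Proof.
move=> wW; rewrite mdegE big_distrr /=; apply: leq_sum => i _.
by rewrite mulnC leq_mul2r wW orbT.
Qed.

(** A lower bound on the weighted degree, unlike homogeneity, is stable under arbitrary multiples
    and so defines an ideal. *)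
Definition wdeg_ge (R : nzRingType) (d : nat) (p : {mpoly R[s]}) : Prop :=
  forall m, m \in msupp p -> (d <= wdeg w m)%N.

Section ComRing.
Variable (R : comNzRingType).
Implicit Types p q : {mpoly R[s]}.

Lemma wdeg_ge_mul d e p q :
  wdeg_ge d p -> wdeg_ge e q -> wdeg_ge (d + e) (p * q).
Proof.
move=> dp eq m /msuppM_le/allpairsP[[m1 m2] /= [/dp le1 /eq le2 ->]].
by rewrite wdegD leq_add.
Qed.

Lemma wdeg_ge0 p : wdeg_ge 0 p. Proof. by []. Qed.

Lemma wdeg_ge_ideal d : is_ideal (@wdeg_ge R d).
Proof.
split=> [m|p q dp dq m|a p dp]; first by rewrite msupp0.
  by move=> /msuppD_le; rewrite mem_cat => /orP[/dp|/dq].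
by rewrite -[d]add0n; apply: wdeg_ge_mul.
Qed.

Lemma wdeg_ge_homog d p : weighted_homog w d p -> wdeg_ge d p.
Proof. by move=> /dhomogP hp m /hp ->. Qed.

Lemma msupp_mderivm p m m' : m \in msupp p^`M[m'] -> (m' + m)%MM \in msupp p.
Proof.
by rewrite !mcoeff_msupp mcoeff_mderivm; apply: contraNneq => ->; rewrite mul0rn.
Qed.

Lemma msupp_mderiv p i m : m \in msupp p^`M(i) -> (U_(i) + m)%MM \in msupp p.
Proof. by rewrite -mderivmU1m; apply: msupp_mderivm. Qed.

Lemma wdeg_ge_mderivm d p m :
  weighted_homog w d p -> wdeg_ge (d - wdeg w m) p^`M[m].
Proof.
move=> /dhomogP hp m' /msupp_mderivm/hp/=.
by rewrite wdegD => <-; rewrite addKn.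
Qed.

Lemma homog_mderiv d p i :
  weighted_homog w d p -> weighted_homog w (d - w i) p^`M(i).
Proof.
move=> /dhomogP hp; apply/dhomogP => m /msupp_mderiv/hp /= <-.
by rewrite wdegD wdeg1 addKn.
Qed.

End ComRing.

Section Minors.
Variables (K : fieldType) (n : nat) (f : {mpoly K[s]}) (d W : nat).
Hypothesis f_homog : weighted_homog w d f.
Hypothesis wW : forall i, (w i <= W)%N.

Lemma jac_entry_neq0_mdeg (b a : 'X_{1..s}) :
  jac_entry f b a != 0 -> (mdeg b < mdeg a)%N.
Proof.
rewrite /jac_entry; case: ifP; last by rewrite eqxx.
move=> /andP[ba ne _]; rewrite -(submK ba) mdegD -[X in (X < _)%N]add0n ltn_add2r.
rewrite lt0n mdeg_eq0; apply: contraNneq ne => ab0.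
by rewrite -(submK ba) ab0 add0m.
Qed.

(** A nonzero such entry is a scalar multiple of a derivative of order at most 1, which lowers the
    weighted degree by at most [W]. *)
Lemma wdeg_ge_jac_entry (b a : 'X_{1..s}) :
  (mdeg a <= (mdeg b).+1)%N -> wdeg_ge (d - W) (jac_entry f b a).
Proof.
move=> ab; have [ideal0 _ idealM] := wdeg_ge_ideal K (d - W).
rewrite /jac_entry; case: ifP => [/andP[ba _]|_]; last exact: ideal0.
rewrite -mul_mpolyC; apply: idealM => m /(wdeg_ge_mderivm f_homog).
apply: leq_trans; apply: leq_sub2l; apply: leq_trans (wdeg_le _ wW) _.
rewrite -{2}[W]muln1 leq_mul2l; apply/orP; right.
by rewrite -(leq_add2r (mdeg b)) -mdegD submK // add1n.
Qed.

Hypotheses (s_gt0 : (0 < s)%N) (n_ge2 : (2 <= n)%N) (d_ge : (2 * W <= d)%N).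

(* A nonzero entry of a row [b] with [|b| = n - 1] is a first derivative of [f].
   There are at least two such rows, unless [s = 1]; in that case the row of
   index [n - 1] uses up the only column of index [n], and the row of index
   [n - 2] is the second one. *)
Lemma wdeg_ge_minor p : is_maximal_minor n f p -> wdeg_ge d p.
Proof.
case=> g g_incr ->.
have g_inj : injective g.
  move=> i j; case: (ltngtP i j) => [/g_incr|/g_incr|/val_inj //].
    by move=> + eq_g; rewrite eq_g ltnn.
  by move=> + eq_g; rewrite eq_g ltnn.
have idealF := wdeg_ge_ideal K d; have [_ _ idealM] := idealF.
apply: ideal_sum => // sigma _; apply: idealM.
pose row (i : 'I_#|jac_rows s n|) : 'X_{1..s} := bmnm (enum_val i).
pose col i : 'X_{1..s} := bmnm (val (enum_val (g (sigma i)) : jac_cols s n)).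
have -> : \prod_i (colsub g (higher_jacobian n f)) i (sigma i) =
    \prod_i jac_entry f (row i) (col i).
  by apply: eq_bigr => i _; rewrite !mxE.
have [[i zi]|nz] := pselect (exists i, jac_entry f (row i) (col i) = 0).
  by rewrite (bigD1 i) //= zi mul0r; case: idealF.
have lt_rc i : (mdeg (row i) < mdeg (col i))%N.
  by apply: jac_entry_neq0_mdeg; apply/eqP => zi; apply: nz; exists i.
have col_le i : (mdeg (col i) <= n)%N by rewrite -ltnS; apply: bmdeg.
(* Two such factors contribute [2 * (d - W)], at least [d] because [2 * W <= d]. *)
have two i1 i2 : i1 != i2 -> (mdeg (col i1) <= (mdeg (row i1)).+1)%N ->
    (mdeg (col i2) <= (mdeg (row i2)).+1)%N ->
    wdeg_ge d (\prod_i jac_entry f (row i) (col i)).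
  move=> ne le1 le2; rewrite (bigD1 i1) //= (bigD1 i2) 1?eq_sym //= mulrA.
  move=> m /(wdeg_ge_mul (wdeg_ge_mul (wdeg_ge_jac_entry le1) (wdeg_ge_jac_entry le2))
     (@wdeg_ge0 _ _)).
  by apply: leq_trans; lia.
have row_of (m : 'X_{1..s}) : (mdeg m < n)%N -> exists i, row i = m.
  by move=> mn; exists (enum_rank (BMultinom mn)); rewrite /row enum_rankK.
pose o := Ordinal s_gt0.
have [i1 row1] : exists i, row i = (U_(o) *+ n.-1)%MM.
  by apply: row_of; rewrite mdegMn mdeg1 mul1n; lia.
have mdeg_row1 : mdeg (row i1) = n.-1 by rewrite row1 mdegMn mdeg1 mul1n.
have le1 : (mdeg (col i1) <= (mdeg (row i1)).+1)%N.
  by apply: leq_trans (col_le i1) _; lia.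
have [s_gt1|s_le1] := ltnP 1 s.
  pose o' := Ordinal s_gt1.
  have [i2 row2] : exists i, row i = (U_(o') *+ n.-1)%MM.
    by apply: row_of; rewrite mdegMn mdeg1 mul1n; lia.
  apply: (two i1 i2) => //; last first.
    by apply: leq_trans (col_le i2) _; rewrite row2 mdegMn mdeg1 mul1n; lia.
  apply/eqP => eq_i; have := row1; rewrite eq_i row2 => /mnmP/(_ o).
  by rewrite !mulmnE !mnm1E eqxx; move: n_ge2; case: n => [|[]].
have [i2 row2] : exists i, row i = (U_(o) *+ n.-2)%MM.
  by apply: row_of; rewrite mdegMn mdeg1 mul1n; lia.
have mdeg_row2 : mdeg (row i2) = n.-2 by rewrite row2 mdegMn mdeg1 mul1n.
have ne_i : i1 != i2.
  by apply/eqP => eq_i; move: mdeg_row1; rewrite eq_i mdeg_row2; lia.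
have ord_o (i : 'I_s) : i = o by apply: val_inj => /=; have := ltn_ord i; lia.
(* In one variable the degree determines the multi-index, so the distinct columns of [i1] and [i2]
   have distinct degrees. *)
have mdeg_inj (m m' : 'X_{1..s}) : mdeg m = mdeg m' -> m = m'.
  rewrite !mdegE (bigD1 o) //= big1 ?addn0 => [|i /eqP[]]; last exact: ord_o.
  rewrite (bigD1 o) //= big1 ?addn0 => [eq_o|i /eqP[]]; last exact: ord_o.
  by apply/mnmP => i; rewrite (ord_o i).
have ne_col : mdeg (col i2) != mdeg (col i1).
  apply/eqP => /mdeg_inj/val_inj/val_inj/enum_val_inj/g_inj/perm_inj eq_i.
  by rewrite eq_i eqxx in ne_i.
apply: (two i1 i2) => //.
have := lt_rc i1; have := col_le i1; have := col_le i2; move: ne_col.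
by rewrite mdeg_row1 mdeg_row2; lia.
Qed.

Lemma wdeg_ge_higher_ideal p :
  gen_ideal ([set f] `|` higher_jacobian_ideal n f)%classic p -> wdeg_ge d p.
Proof.
have idealF := wdeg_ge_ideal K d; have [_ _ idealM] := idealF.
have gen (S : set {mpoly K[s]}) : (forall q, S q -> wdeg_ge d q) ->
    forall q, gen_ideal S q -> wdeg_ge d q.
  move=> Sd q [r Sr ->]; rewrite big_seq; apply: ideal_sum => // x /Sr Sx.
  by apply: idealM; apply: Sd.
apply: (gen) => q [-> |]; first exact: wdeg_ge_homog.
by apply: (gen (is_maximal_minor n f)) => q'; apply: wdeg_ge_minor.
Qed.

End Minors.
End WeightFiltration.

(** * Syzygies of the partial derivatives *)

Definition span_ideal (A : comNzRingType) (s : nat) (g : 'I_s -> A) (p : A) : Prop :=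
  exists c : 'I_s -> A, p = \sum_i c i * g i.

Lemma span_ideal_ideal (A : comNzRingType) (s : nat) (g : 'I_s -> A) :
  is_ideal (span_ideal g).
Proof.
split=> [|_ _ [b ->] [c ->]|a _ [c ->]].
- by exists (fun=> 0); rewrite big1 // => i _; rewrite mul0r.
- by exists (fun i => b i + c i); rewrite -big_split; apply: eq_bigr => i _; rewrite mulrDl.
- by exists (fun i => a * c i); rewrite mulr_sumr; apply: eq_bigr => i _; rewrite mulrA.
Qed.

Lemma span_ideal_gen (A : comNzRingType) (s : nat) (g : 'I_s -> A) i :
  span_ideal g (g i).
Proof.
exists (fun j => (j == i)%:R); rewrite (bigD1 i) //= eqxx mul1r big1 ?addr0 //.
by move=> j /negbTE ->; rewrite mul0r.
Qed.

Section PowersOfVariables.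
Variables (R : comNzRingType) (s N : nat).
Local Notation A := {mpoly R[s]}.

(** The monomial ideal generated by [X_0^N], ..., [X_(k-1)^N]; membership is read off the
    support. *)
Definition var_power_ideal (k : nat) (p : A) : Prop :=
  forall m, m \in msupp p -> exists2 j : 'I_s, (j < k)%N & (N <= m j)%N.

Lemma var_power_ideal_ideal k : is_ideal (var_power_ideal k).
Proof.
split=> [m|p q kp kq m|a p kp m]; first by rewrite msupp0.
  by move=> /msuppD_le; rewrite mem_cat => /orP[/kp|/kq].
move=> /msuppM_le/allpairsP[[m1 m2] /= [_ /kp[j jk Nj] ->]].
by exists j => //; rewrite mnmDE (leq_trans Nj) ?leq_addl.
Qed.

Lemma var_power_ideal_sub k p : var_power_ideal k p -> var_power_ideal k.+1 p.
Proof. by move=> kp m /kp[j jk Nj]; exists j; rewrite // ltnW. Qed.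

Lemma var_power_ideal_var (o : 'I_s) : var_power_ideal o.+1 ('X_o ^+ N).
Proof.
move=> m; rewrite mpolyXn msuppX inE => /eqP ->.
by exists o; rewrite // mulmnE mnm1E eqxx mul1n.
Qed.

(** Sort the monomials by whether [X_o] has exponent at least [N]; those where it does not are
    divisible by the [N]-th power of an earlier variable. *)
Lemma var_power_ideal_split (o : 'I_s) p : var_power_ideal o.+1 p ->
  exists u v, p = 'X_o ^+ N * u + v /\ var_power_ideal o v.
Proof.
move=> op.
exists (\sum_(m <- msupp p | (N <= m o)%N) p@_m *: 'X_[m - U_(o) *+ N]).
exists (\sum_(m <- msupp p | (N > m o)%N) p@_m *: 'X_[m]); split.
  rewrite {1}[p]mpolyE (bigID (fun m : 'X_{1..s} => N <= m o)%N) /=; congr (_ + _); last first.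
    by apply: eq_bigl => m; rewrite -ltnNge.
  rewrite mulr_sumr; apply: eq_bigr => m Nm; rewrite -scalerAr mpolyXn -mpolyXD.
  rewrite addmC submK //; apply/mnm_lepP => j; rewrite mulmnE mnm1E.
  by case: eqP => [<-|]; rewrite ?mul1n.
rewrite big_seq_cond; apply: ideal_sum => [|m /andP[pm mN]].
  exact: var_power_ideal_ideal.
rewrite -mul_mpolyC; case: (var_power_ideal_ideal o) => _ _; apply => m'.
rewrite msuppX inE => /eqP ->; have [j] := op m pm; rewrite ltnS leq_eqVlt.
move=> /orP[/eqP/val_inj ->|jo Nj]; last by exists j.
by rewrite leqNgt mN.
Qed.

(** Multiplying by a power of [X_o] leaves the exponents of the earlier variables unchanged. *)
Lemma var_power_ideal_regular (o : 'I_s) p :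
  var_power_ideal o ('X_o ^+ N * p) -> var_power_ideal o p.
Proof.
move=> op m pm; have [|j jo] := op (U_(o) *+ N + m)%MM.
  by rewrite mulrC mpolyXn mcoeff_msupp mcoeffMX -mcoeff_msupp.
rewrite mnmDE mulmnE mnm1E -val_eqE /=.
by rewrite [(o : nat) == j]gtn_eqF // mul0n add0n; exists j.
Qed.

End PowersOfVariables.

(** The powers [X_i^N] form a regular sequence in the ideal of [g], so [koszul_syzygy] applies with
    them as [theta]. *)
Lemma mpoly_syzygy (R : comNzRingType) (s N : nat) (g a : 'I_s -> {mpoly R[s]}) :
  (forall i, span_ideal g ('X_i ^+ N)) -> \sum_i a i * g i = 0 ->
  forall i, span_ideal g (a i).
Proof.
case: s g a => [|s] g a gX rel i; first by case: i.
rewrite -(inord_val i).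
apply: (@koszul_syzygy _ s.+1 (fun i => g (inord i)) (fun i => 'X_(inord i) ^+ N)
  (@var_power_ideal R s.+1 N) _ _ _ _ _ _ _ (fun i => a (inord i))) => //.
- exact: var_power_ideal_ideal.
- exact: var_power_ideal_sub.
- by move=> k ks; have := @var_power_ideal_var R _ N (inord k : 'I_s.+1); rewrite inordK.
- move=> k p ks; have := @var_power_ideal_split R _ N (inord k : 'I_s.+1) p.
  by rewrite inordK.
- move=> k p ks; have := @var_power_ideal_regular R _ N (inord k : 'I_s.+1) p.
  by rewrite inordK.
- move=> k ks; have [c ->] := gX (inord k); exists (fun i => c (inord i)).
  by apply: eq_bigr => j _; rewrite inord_val.
- exact: span_ideal_ideal.
- by move=> k _; apply: span_ideal_gen.
- move=> p p0; apply/eqP; rewrite -msupp_eq0; case def_p: (msupp p) => [//|m r].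
  by have [|j] := p0 m; first by rewrite def_p mem_head.
- by rewrite -[RHS]rel; apply: eq_bigr => j _; rewrite inord_val.
Qed.

(** * Isolatedness and the common zeros of the partial derivatives *)

Section SingularLocus.
Import numFieldTopology.Exports.
Variables (R : realType) (s : nat) (w : 'I_s -> nat) (d : nat).
Variable f : {mpoly (R[i])[s]}.
Hypothesis f_homog : weighted_homog w d f.

(** Each monomial is an eigenvector of the weighted Euler operator, with its weighted degree as
    eigenvalue. *)
Lemma weighted_euler :
  \sum_i (w i)%:R *: ('X_i * f^`M(i)) = d%:R *: f.
Proof.
rewrite [f in LHS]mpolyE [f in RHS]mpolyE scaler_sumr.
under eq_bigr => i _ do rewrite raddf_sum mulr_sumr scaler_sumr.
rewrite exchange_big /= big_seq [RHS]big_seq; apply: eq_bigr => m fm.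
have := f_homog => /dhomogP/(_ m fm) <-; rewrite /wdeg natr_sum scaler_suml.
apply: eq_bigr => i _; rewrite mderivZ mderivX -!scalerAr -mpolyXD natrM.
have [m0|m_gt0] := posnP (m i); first by rewrite m0 scale0r scaler0 scaler0 mul0r scale0r.
rewrite addmC submK; last by rewrite lep1mP -lt0n.
by rewrite !scalerA; congr (_ *: _); rewrite [f@_m * _]mulrC mulrCA mulrA.
Qed.

Lemma meval_weighted_scale e (p : {mpoly (R[i])[s]}) (v : 'I_s -> R[i]) l :
  weighted_homog w e p -> p.@[fun i => l ^+ w i * v i] = l ^+ e * p.@[v].
Proof.
move=> /dhomogP hp; rewrite !mevalE mulr_sumr big_seq [RHS]big_seq.
apply: eq_bigr => m /hp <-; rewrite mulrCA; congr (_ * _).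
rewrite /wdeg -prodrXr -big_split; apply: eq_bigr => i _ /=.
by rewrite exprMn -exprM mulnC.
Qed.

Hypotheses (d_gt0 : (0 < d)%N) (w_gt0 : forall i, (0 < w i)%N).
Hypothesis f_isolated : isolated_singularity f.

(** By Euler's identity [f] vanishes too, and the weighted scalings of [v] are again singular. For
    small [l > 0] the scaled point enters the neighbourhood isolating the origin, so it is 0. *)
Lemma singular_point_eq0 (v : 'I_s -> R[i]) :
  (forall i, f^`M(i).@[v] = 0) -> forall i, v i = 0.
Proof.
move=> dfv j.
have sing (l : R[i]) : [set u : 'rV[(R[i] : numFieldType)]_s |
    f.@[u 0] = 0 /\ forall i : 'I_s, f^`M(i).@[u 0] = 0]%classic
    (\row_i (l ^+ w i * v i)).
  have row_v : (\row_i (l ^+ w i * v i) : 'rV[R[i]]_s) 0 =1 fun i => l ^+ w i * v i.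
    by move=> i; rewrite mxE.
  split=> [|i] /=; last first.
    by rewrite (meval_eq _ row_v) (meval_weighted_scale _ _ (homog_mderiv i f_homog))
      dfv mulr0.
  rewrite (meval_eq _ row_v) (meval_weighted_scale _ _ f_homog).
  have := congr1 (meval v) weighted_euler; rewrite raddf_sum mevalZ /= big1 => [|i _].
    move/esym/eqP; rewrite mulf_eq0 pnatr_eq0 eqn0Ngt d_gt0 /= => /eqP ->.
    by rewrite mulr0.
  by rewrite mevalZ mevalM dfv !mulr0.
have [_ [V V0 VA]] := f_isolated.
have [e e_gt0 ballV] : exists2 e : R[i], 0 < e &
    (ball (0 : 'rV[(R[i] : numFieldType)]_s) e `<=` V)%classic.
  exact/nbhs_ballP.
(* Chosen so that [l <= 1] and [l * |v i| < e]; as [w i >= 1], also [l ^+ w i * |v i| < e]. *)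
pose l := e / (1 + e + \sum_i `|v i|).
have sum_ge0 : 0 <= \sum_i `|v i| by apply: sumr_ge0.
have den_gt0 : 0 < 1 + e + \sum_i `|v i|.
  by rewrite ltr_pwDl // addr_gt0.
have l_gt0 : 0 < l by rewrite divr_gt0.
have l_le1 : l <= 1.
  by rewrite ler_pdivrMr // mul1r -addrA addrCA lerDl addr_ge0.
have inV : V (\row_i (l ^+ w i * v i)).
  apply: ballV; split=> // i0 i; rewrite !mxE /ball /= sub0r normrN normrM.
  have -> : `|l ^+ w i| = l ^+ w i by rewrite ger0_norm // exprn_ge0 // ltW.
  apply: (@le_lt_trans _ _ (l * `|v i|)).
    apply: ler_wpM2r => //; rewrite -[X in _ <= X]expr1.
    by apply: ler_wiXn2l => //; apply: ltW.
  rewrite /l mulrAC ltr_pdivrMr // ltr_pM2l //.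
  rewrite (bigD1 i) //= addrCA ltrDl ltr_pwDl //; first by rewrite addr_gt0.
  by rewrite sumr_ge0.
have : (V `&` [set u : 'rV[(R[i] : numFieldType)]_s |
    f.@[u 0] = 0 /\ forall i : 'I_s, f^`M(i).@[u 0] = 0])%classic
    (\row_i (l ^+ w i * v i)) by split => //; apply: sing.
rewrite VA /= => /rowP/(_ j); rewrite !mxE => /eqP.
by rewrite mulf_eq0 expf_eq0 gt_eqF ?andbF //= => /eqP.
Qed.

(** Each variable vanishes at the common zeros of the partials, so the Nullstellensatz applies to
    it; the sum of the exponents serves all variables. *)
Lemma partials_contain_var_powers :
  exists N, forall i, span_ideal (fun j => f^`M(j)) ('X_i ^+ N).
Proof.
have pow (i : 'I_s) : exists N, span_ideal (fun j => f^`M(j)) ('X_i ^+ N).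
  apply: nullstellensatz; [exact: complex_not_countable_union_seq|exact: span_ideal_ideal|].
  move=> v zeros; rewrite mevalXU; apply: singular_point_eq0 => j.
  by apply: zeros; apply: span_ideal_gen.
have [N NP] := choice pow; exists (\sum_i N i)%N => i.
rewrite (bigD1 i) //= addnC exprD.
by case: (span_ideal_ideal (fun j => f^`M(j))) => _ _; apply.
Qed.

End SingularLocus.

(** * Derivations of negative degree *)

Theorem theorem1 (R : realType) (s : nat) (hs : (0 < s)%N)
    (f : {mpoly (R[i])[s]}) (d : nat) (w : 'I_s -> nat)
    (f_homog : weighted_homog w d f)
    (f_isolated : isolated_singularity f)
    (d_ge : (2 * w (Ordinal hs) <= d)%N)
    (w_noninc : forall i j : 'I_s, (i <= j)%N -> (2 * w j <= 2 * w i)%N)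
    (w_pos : forall i : 'I_s, (0 < 2 * w i)%N)
    (n : nat) (hn : (2 <= n)%N)
    (k : int) (delta : higher_tjurina_algebra n f -> higher_tjurina_algebra n f)
    (delta_der : is_derivation delta)
    (delta_homog : weighted_homog_map w k delta)
    (hk : k < 0) :
  forall t : higher_tjurina_algebra n f, delta t = 0.
Proof.
set W := w (Ordinal hs) in d_ge.
have wW i : (w i <= W)%N by rewrite -(@leq_pmul2l 2) //; apply: w_noninc.
have w_gt0 i : (0 < w i)%N by have := w_pos i; lia.
have d_gt0 : (0 < d)%N by have := w_gt0 (Ordinal hs); rewrite -/W; lia.
pose S := ([set f] `|` higher_jacobian_ideal n f)%classic.
pose pi : {mpoly (R[i])[s]} -> quot_alg S := quot_proj S.
have [delta_lin delta_mul] := delta_der.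
have deltaD t u : delta (t + u) = delta t + delta u.
  by have := delta_lin 1 t u; rewrite !scale1r.
have delta0 : delta 0 = 0 by apply: (addrI (delta 0)); rewrite -deltaD !addr0.
have deltaZ c t : delta (c *: t) = c *: delta t.
  by have := delta_lin c t 0; rewrite delta0 !addr0.
(* In negative degree the graded piece is zero and [0] is the lift; the degree condition, stated on
   the support, then holds vacuously. *)
have lift i : exists a : {mpoly (R[i])[s]}, delta (pi 'X_i) = pi a /\
    forall m, m \in msupp a -> (wdeg w m)%:Z = (w i)%:Z + k.
  have : graded_piece w ((w i)%:Z + k) (delta (pi 'X_i)).
    apply: delta_homog; exists (pi 'X_i) => //; exists 'X_i => //.
    by apply/dhomogP => m; rewrite msuppX inE => /eqP ->; apply: wdeg1.
  case: ((w i)%:Z + k) => e /=.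
    by case=> p /dhomogP hp ->; exists p; split=> // m /hp /= ->.
  by move=> ->; exists 0; split=> [|m]; rewrite ?msupp0 // /pi /quot_proj raddf0.
have [a aP] := choice lift.
pose D p := \sum_i a i * p^`M(i).
have DD p q : D (p + q) = D p + D q.
  by rewrite /D -big_split; apply: eq_bigr => i _; rewrite mderivD mulrDr.
have DZ c p : D (c *: p) = c *: D p.
  by rewrite /D scaler_sumr; apply: eq_bigr => i _; rewrite mderivZ scalerAr.
have DM p q : D (p * q) = D p * q + p * D q.
  rewrite /D mulr_suml mulr_sumr -big_split; apply: eq_bigr => i _.
  by rewrite mderivM mulrDr; congr (_ + _); rewrite ?mulrA // [p * a i]mulrC.
(* Both sides are linear, obey the Leibniz rule and agree on the variables. *)
have delta_pi p : delta (pi p) = pi (D p).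
  have piM p1 p2 : delta (pi p1) = pi (D p1) -> delta (pi p2) = pi (D p2) ->
      delta (pi (p1 * p2)) = pi (D (p1 * p2)).
    by move=> e1 e2; rewrite /pi quot_projM delta_mul e1 e2 DM quot_projD !quot_projM.
  have pi1 : delta (pi 1) = pi (D 1).
    have d1 : delta 1 = 0.
      by apply: (addrI (delta 1)); rewrite addr0 -[in RHS](mulr1 1) delta_mul mulr1 mul1r.
    rewrite /pi quot_proj1 d1 /D big1 => [|i _].
      by rewrite /quot_proj raddf0.
    by rewrite -mpolyC1 mderivC mulr0.
  elim/mpolyind: p => [|c m p _ _ IH].
    by rewrite /D big1 => [|i _]; rewrite ?mderiv0 ?mulr0 // /pi /quot_proj raddf0.
  rewrite DD DZ /pi !quot_projD !quot_projZ deltaD deltaZ IH; congr (_ *: _ + _).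
  rewrite mpolyXE_id.
  apply: (big_ind (fun q => delta (pi q) = pi (D q))) => [//|//|i _].
  elim: (m i) => [|j IHj]; first by rewrite expr0.
  rewrite exprS; apply: piM => //; rewrite (aP i).1; congr pi.
  rewrite /D (bigD1 i) //= mderivX mnm1E eqxx scale1r.
  rewrite -{1}[U_(i)%MM]add0m addmK mpolyX0 mulr1 big1 ?addr0 //.
  by move=> j' ne; rewrite mderivX mnm1E eq_sym (negbTE ne) scale0r mulr0.
have Df0 : D f = 0.
  have ge_d : wdeg_ge w d (D f).
    apply: (wdeg_ge_higher_ideal f_homog wW hs hn d_ge).
    have -> : D f = D f - 0 by rewrite subr0.
    apply/quot_projP; rewrite -/(pi _) -delta_pi.
    have -> : pi f = 0.
      rewrite -[RHS](_ : pi 0 = 0); last by rewrite /pi /quot_proj raddf0.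
      apply/quot_projP; exists [:: (1, f)] => [x|]; first by rewrite inE => /eqP ->; left.
      by rewrite big_seq1 mul1r subr0.
    by rewrite delta0 /pi /quot_proj raddf0.
  (* A monomial of [D f] has degree [(w_i + k) + (d - w_i) = d + k < d], against [ge_d]. *)
  apply/eqP; rewrite -msupp_eq0; case def_D: (msupp (D f)) => [//|m r].
  have mD : m \in msupp (D f) by rewrite def_D mem_head.
  have := ge_d m mD.
  move: mD => /msupp_sum_le/flatten_mapP[i _ /msuppM_le/allpairsP[[m1 m2] /=]].
  case=> /(aP i).2 hm1 /msupp_mderiv hm2 ->; rewrite wdegD.
  have := f_homog => /dhomogP/(_ _ hm2) /=; rewrite wdegD wdeg1; lia.
have a0 i : a i = 0.
  have [N NP] := partials_contain_var_powers f_homog d_gt0 w_gt0 f_isolated.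
  have [c ac] := mpoly_syzygy NP Df0 i.
  (* A monomial of [a i] would have degree [w_i + k < W <= d - W], while the ideal of the partials
     starts in degree [d - W]. *)
  apply/eqP; rewrite -msupp_eq0; case def_a: (msupp (a i)) => [//|m r].
  have ma : m \in msupp (a i) by rewrite def_a mem_head.
  have := (aP i).2 m ma.
  have : wdeg_ge w (d - W) (a i).
    have idealF := wdeg_ge_ideal w R[i] (d - W); have [_ _ idealM] := idealF.
    rewrite ac; apply: ideal_sum => // j _; apply: idealM => m'.
    move=> /(wdeg_ge_homog (homog_mderiv j f_homog)).
    by apply: leq_trans; apply: leq_sub2l.
  by move=> /(_ m ma); have := wW i; lia.
move=> t; have [p ->] := quot_proj_surj t.
rewrite -/(pi p) delta_pi /D big1 => [|i _]; last by rewrite a0 mul0r.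
by rewrite /pi /quot_proj raddf0.
Qed.
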